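(* Let $G$ and $H$ be isoclinic finite groups. Then $\frac{T(G)}{|G|}=\frac{T(H)}{|H|}$.
   Context: For a finite group $G$, $\mathrm{Irr}(G)$ denotes the set of irreducible complex characters of $G$, and $T(G)=\sum_{\chi\in\mathrm{Irr}(G)}\chi(1)$ is the sum of their degrees. Two groups $G$ and $H$ are isoclinic if there are isomorphisms $\varphi:G/\mathbf{Z}(G)\to H/\mathbf{Z}(H)$ and $\phi:G'\to H'$ such that whenever $\varphi(g_1\mathbf{Z}(G))=h_1\mathbf{Z}(H)$ and $\varphi(g_2\mathbf{Z}(G))=h_2\mathbf{Z}(H)$, one has $\phi([g_1,g_2])=[h_1,h_2]$. Here $\mathbf{Z}(G)$ is the center and $G'$ the derived (commutator) subgroup of $G$. *)

(* Defs.v *)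
From mathcomp Require Import all_boot all_order all_algebra all_fingroup.
From mathcomp Require Import all_solvable all_field all_character.

Set Implicit Arguments.
Unset Strict Implicit.
Unset Printing Implicit Defensive.

Import GroupScope GRing.Theory.

(* Here [~ x, y] is x^-1 * y^-1 * x * y. The other usual convention,
   x * y * x^-1 * y^-1, yields the same relation, as one sees by replacing all
   the elements involved by their inverses. *)
Definition isoclinic (gT hT : finGroupType) (G : {group gT}) (H : {group hT})
    : Prop :=
  exists (phi : {morphism G / 'Z(G) >-> coset_of 'Z(H)})
         (psi : {morphism G^`(1) >-> hT}),
    [/\ isom (G / 'Z(G)) (H / 'Z(H)) phi,
        isom G^`(1) H^`(1) psi
      & forall g1 g2 h1 h2,
          g1 \in G -> g2 \in G -> h1 \in H -> h2 \in H ->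
          phi (coset 'Z(G) g1) = coset 'Z(H) h1 ->
          phi (coset 'Z(G) g2) = coset 'Z(H) h2 ->
          psi [~ g1, g2] = [~ h1, h2]].

(* Complex characters are taken in algC, the field of algebraic numbers, which
   contains all their values. *)
Definition degree_sum (gT : finGroupType) (G : {group gT}) : algC :=
  (\sum_(i : Iirr G) 'chi_i 1%g)%R.

(* Main.v *)
Require Import Defs.
From mathcomp Require Import all_boot all_order all_algebra all_fingroup.
From mathcomp Require Import all_solvable all_field all_character.

(** Let P be the fibre product of G and H over their common central quotient.
    The projections of P are onto G and H, and since P' consists of pairs
    (c, psi c) both kernels meet P' trivially. It remains to see that T(P)/|P|
    is unchanged when P is divided by a normal subgroup N with N :&: P' = 1.
    Averaging over N the class function x |-> \sum_i 'chi_i x gives the sum of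
    the degrees of the irreducible characters of P / N; on the other hand this
    function vanishes outside P', as it is invariant under multiplication by
    any linear character, so the average is T(P) / |N|. *)

Set Implicit Arguments.
Unset Strict Implicit.
Unset Printing Implicit Defensive.

Import GroupScope GRing.Theory Num.Theory.

Local Open Scope ring_scope.

Lemma sum_irr_eq0 (gT : finGroupType) (G : {group gT}) (x : gT) :
  x \notin G^`(1)%g -> \sum_i 'chi[G]_i x = 0.
Proof.
move=> notG'x; have [Gx | notGx] := boolP (x \in G); last first.
  by apply: big1 => i _; rewrite cfun0.
have [i lin_i ker'x]:
    exists2 i, 'chi[G]_i \is a linear_char & x \notin cfker 'chi_i.
  apply/exists_inP; apply: contraR notG'x; rewrite negb_exists_in.
  move/forall_inP=> kerx; rewrite -cap_cfker_lin_irr.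
  by apply/bigcapP=> i lin_i; apply: contraLR (kerx i lin_i) => /= ->.
pose mul_i j := cfIirr ('chi_i * 'chi[G]_j).
have mul_iE j : 'chi_(mul_i j) = 'chi_i * 'chi_j.
  by rewrite cfIirrE // mul_lin_irr ?mem_irr.
have mul_i_inj : injective mul_i.
  move=> j k /(congr1 (fun l => 'chi_l)); rewrite !mul_iE.
  by move/(mulrI (lin_char_unitr lin_i))/irr_inj.
have chi_x1 : 'chi_i x != 1.
  by apply: contraNneq ker'x => chi1; rewrite cfkerEirr inE chi1 lin_char1.
(* Multiplication by ['chi_i] permutes the irreducible characters; reindexing the subtracted copy of
   the sum by [mul_i] cancels it termwise. *)
have: ('chi_i x - 1) * \sum_j 'chi[G]_j x = 0.
  rewrite mulrBl mul1r {2}(reindex_inj mul_i_inj) mulr_sumr -sumrB.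
  by apply: big1 => j _; rewrite mul_iE cfunE subrr.
by move/eqP; rewrite mulf_eq0 subr_eq0 (negPf chi_x1) => /eqP.
Qed.

(** Up to the factor [#|N|], the sum is the multiplicity of the trivial character in ['Res[N]
    'chi_i]. As [N] is normal, this is nonzero only when [N] lies in the kernel. *)
Lemma sum_irr_normal (gT : finGroupType) (G N : {group gT}) (i : Iirr G) :
  N <| G ->
  \sum_(x in N) 'chi_i x =
    if N \subset cfker 'chi_i then #|N|%:R * 'chi_i 1%g else 0.
Proof.
move=> nsNG; have sNG := normal_sub nsNG.
case: ifPn => [kerN | ker'N].
  rewrite -sumr_const mulr_suml; apply: eq_bigr => x Nx; rewrite mul1r.
  by have:= subsetP kerN x Nx; rewrite cfkerEirr inE => /eqP.
have: '['Res[N] 'chi_i, 'chi_0] = 0.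
  by apply/eqP; apply: contraR ker'N => /constt0_Res_cfker->.
rewrite cfdotE => /eqP; rewrite mulf_eq0 invr_eq0.
rewrite (negPf (neq0CG N)) => /eqP sum0.
rewrite -[RHS]sum0; apply: eq_bigr => x Nx.
by rewrite irr0 cfun1E Nx conjC1 mulr1 cfResE.
Qed.

Lemma degree_sum_quotient (gT : finGroupType) (G N : {group gT}) :
  N <| G -> (N :&: G^`(1) = 1)%g ->
  degree_sum G = #|N|%:R * degree_sum (G / N).
Proof.
move=> nsNG tiNG'.
have <- : \sum_(x in N) \sum_i 'chi[G]_i x = degree_sum G.
  rewrite (bigD1 1%g) ?group1 //= [X in _ + X]big1 ?addr0 // => x.
  case/andP=> Nx ntx; apply: sum_irr_eq0; apply: contraNN ntx => G'x.
  by rewrite -in_set1 -[[set 1%g]]tiNG' inE Nx.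
rewrite exchange_big /= (eq_bigr _ (fun i _ => sum_irr_normal i nsNG)).
(* The surviving characters are the inflations from [G / N], which keep their degrees. *)
rewrite -big_mkcond mulr_sumr (reindex _ (mod_Iirr_bij nsNG)) /=.
by apply: eq_big => [i | i _]; rewrite mod_IirrE ?cfker_mod ?cfMod1.
Qed.

Lemma degree_sum_isog (gT hT : finGroupType) (G : {group gT})
    (H : {group hT}) :
  G \isog H -> degree_sum G = degree_sum H.
Proof.
case/isogP=> f injf fG; have isoGH : isom G H f by apply/isomP.
rewrite /degree_sum (reindex (isom_Iirr isoGH)) /=; last first.
  exists (isom_Iirr (isom_sym isoGH)) => i _; first exact: isom_IirrK.
  exact: isom_IirrKV.
by apply: eq_bigr => i _; rewrite isom_IirrE cfIsom1.
Qed.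

Lemma degree_sum_morphim (gT hT : finGroupType) (D P : {group gT})
    (f : {morphism D >-> hT}) :
  P \subset D -> ('ker_P f :&: P^`(1) = 1)%g ->
  degree_sum (f @* P) / #|f @* P|%:R = degree_sum P / #|P|%:R.
Proof.
move=> sPD tiKP'; have nsKP : 'ker_P f <| P by apply: normalGI sPD (ker_normal f).
have isoPK := first_isog_loc f sPD.
rewrite -(degree_sum_isog isoPK) -(card_isog isoPK).
rewrite (degree_sum_quotient nsKP tiKP') -(Lagrange (normal_sub nsKP)).
by rewrite card_quotient ?normal_norm // natrM -mulf_div divff ?mul1r ?neq0CG.
Qed.

Theorem theorem13 (gT hT : finGroupType) (G : {group gT}) (H : {group hT})
    (isoGH : isoclinic G H) :
  (degree_sum G / #|G|%:R = degree_sum H / #|H|%:R)%R.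
Proof.
case: isoGH => phi [psi [/isomP[injphi imphi] /isomP[injpsi impsi] phi_psi]].
have nZG := normal_norm (center_normal G).
have nZH := normal_norm (center_normal H).
pose P := [set x : gT * hT | [&& x.1 \in G, x.2 \in H
  & phi (coset 'Z(G) x.1) == coset 'Z(H) x.2]].
have P_group : group_set P.
  apply/group_setP; split=> [|x y].
    by rewrite inE /= !group1 !morph1 /=.
  rewrite !inE => /and3P[Gx1 Hx2 /eqP Dx] /and3P[Gy1 Hy2 /eqP Dy] /=.
  have nG := subsetP nZG; have nH := subsetP nZH.
  rewrite !groupM //= !morphM ?mem_quotient ?nG ?nH //.
  by rewrite Dx Dy.
pose PG := group P_group.
(* [Q] is the graph of [psi]. Compatibility of [phi] and [psi] puts the commutators of [P] in it,
   hence all of [P']. *)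
pose Q := [set x : gT * hT | (x.1 \in G^`(1)%g) && (psi x.1 == x.2)].
have Q_group : group_set Q.
  apply/group_setP; split=> [|x y]; first by rewrite inE /= group1 morph1 /=.
  rewrite !inE => /andP[G'x1 /eqP Dx] /andP[G'y1 /eqP Dy] /=.
  by rewrite groupM //= morphM // Dx Dy.
have sP'Q : (PG^`(1) \subset Q)%g.
  rewrite (gen_subG _ (group Q_group)); apply/subsetP=> _ /imset2P[x y Px Py ->].
  move: Px Py; rewrite !inE => /and3P[Gx1 Hx2 /eqP Dx] /and3P[Gy1 Hy2 /eqP Dy].
  by rewrite mem_commg //=; apply/eqP; apply: phi_psi.
have fstP : (fst_morphism gT hT @* PG = G)%g.
  rewrite morphimEsub ?subsetT //; apply/setP=> g; apply/imsetP/idP.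
    by case=> x; rewrite inE => /and3P[Gx1 _ _] ->.
  move=> Gg; have: phi (coset 'Z(G) g) \in (H / 'Z(H))%g.
    by rewrite -imphi mem_morphim ?mem_quotient.
  by case/morphimP=> h _ Hh Dh; exists (g, h); rewrite ?inE /= ?Gg ?Hh ?Dh /=.
have sndP : (snd_morphism gT hT @* PG = H)%g.
  rewrite morphimEsub ?subsetT //; apply/setP=> h; apply/imsetP/idP.
    by case=> x; rewrite inE => /and3P[_ Hx2 _] ->.
  (* Surjectivity of [phi] supplies a first component for [h]. *)
  move=> Hh; have: coset 'Z(H) h \in phi @* (G / 'Z(G))%g.
    by rewrite imphi mem_quotient.
  case/morphimP=> _ _ /morphimP[g _ Gg ->] Dh.
  by exists (g, h); rewrite ?inE /= ?Gg ?Hh ?Dh /=.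
transitivity (degree_sum PG / #|PG|%:R).
  rewrite -(degree_sum_morphim (subsetT PG) (f := fst_morphism gT hT)) ?fstP //.
    by rewrite [(_ @* _)%G](group_inj fstP).
  apply/trivgP/subsetP=> x /setIP[/setIP[_ /morphpreP[_ /set1P x1]]].
  move/(subsetP sP'Q); rewrite inE /= in x1 * => /andP[_ /eqP Dx].
  by rewrite inE [x]surjective_pairing -Dx x1 morph1.
rewrite -(degree_sum_morphim (subsetT PG) (f := snd_morphism gT hT)) ?sndP //.
  by rewrite [(_ @* _)%G](group_inj sndP).
apply/trivgP/subsetP=> x /setIP[/setIP[_ /morphpreP[_ /set1P x2]]].
move/(subsetP sP'Q); rewrite inE /= in x2 * => /andP[G'x1 /eqP Dx].
(* For the second projection, the kernel meets [P'] trivially because [psi] is injective. *)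
have x1: x.1 = 1%g by apply: (injmP injpsi); rewrite ?group1 // morph1 Dx.
by rewrite inE [x]surjective_pairing x1 x2.
Qed.
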